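(* Let $X$ be an infinite discrete space and let ${\rm S}(X)$ be the permutation group of $X$ with the topology $\tau_p$ of pointwise convergence. If $G$ is a subgroup of $({\rm S}(X),\tau_p)$, then the WAP-compactification of $G$ is a proper compactification of $G$.
   Context: The topology $\tau_p$ on ${\rm S}(X)$ has as subbase the sets $\{g\mid g(x)=y\}$, $x,y\in X$ (permutation topology); a subgroup carries the subspace topology. A semitopological semigroup is a semigroup with a topology in which multiplication is separately continuous. The WAP-compactification of a topological group $G$ is the maximal semitopological semigroup compactification: a compact Hausdorff semitopological monoid $W$ with a continuous homomorphism $w:G\to W$ with dense image such that every continuous homomorphism of $G$ into a compact Hausdorff semitopological semigroup factors through $w$. It is proper if $w$ is a topological embedding. *)

(* Defs.v *)
From HB Require Import structures.
From mathcomp Require Import all_boot monoid finmap all_classical topology.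

Set Implicit Arguments.
Unset Strict Implicit.
Unset Printing Implicit Defensive.

Local Open Scope classical_set_scope.
Local Open Scope group_scope.

HB.structure Definition PreTopologicalSemigroup :=
  {S of Topological S & Semigroup S}.

HB.structure Definition PreTopologicalMonoid :=
  {S of Topological S & Monoid S}.

HB.mixin Record PreTopologicalSemigroup_isSemitopological S
    & PreTopologicalSemigroup S := {
  mulgl_continuous : forall a : S, continuous (fun x : S => a * x) ;
  mulgr_continuous : forall a : S, continuous (fun x : S => x * a)
}.

#[short(type="semitopologicalSemigroupType")]
HB.structure Definition SemitopologicalSemigroup :=
  {S of PreTopologicalSemigroup S & PreTopologicalSemigroup_isSemitopological S}.

#[short(type="semitopologicalMonoidType")]
HB.structure Definition SemitopologicalMonoid :=
  {S of SemitopologicalSemigroup S & Monoid S}.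

HB.structure Definition PreTopologicalGroup := {G of Topological G & Group G}.

HB.mixin Record PreTopologicalGroup_isTopologicalGroup G
    & PreTopologicalGroup G := {
  mulg_continuous : continuous (fun x : G * G => x.1 * x.2) ;
  invg_continuous : continuous (fun x : G => x^-1)
}.

#[short(type="topologicalGroupType")]
HB.structure Definition TopologicalGroup :=
  {G of PreTopologicalGroup G & PreTopologicalGroup_isTopologicalGroup G}.

Record symgroup (X : Type) := Symgroup {
  symgroup_fun :> X -> X ;
  symgroup_bij : bijective symgroup_fun
}.

HB.instance Definition _ (X : Type) := gen_eqMixin (symgroup X).
HB.instance Definition _ (X : Type) := gen_choiceMixin (symgroup X).

Section symgroup_group.
Variable X : Type.
Implicit Types f g h : symgroup X.

Lemma symgroupP f g : f =1 g -> f = g.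
Proof.
case: f g => [f fb] [g gb] /= /funext fg.
by rewrite fg in fb *; congr Symgroup; exact: Prop_irrelevance.
Qed.

Definition symgroup_one := @Symgroup X idfun (Bijective (fun=> erefl) (fun=> erefl)).

Definition symgroup_mul f g :=
  Symgroup (bij_comp (symgroup_bij f) (symgroup_bij g)).

Lemma symgroup_inv_exists f :
  exists g : symgroup X, cancel f g /\ cancel g f.
Proof.
case: (symgroup_bij f) => g fK gK.
by exists (Symgroup (Bijective gK fK)).
Qed.

Definition symgroup_inv f := projT1 (cid (symgroup_inv_exists f)).

Lemma symgroup_funK f : cancel f (symgroup_inv f).
Proof. by rewrite /symgroup_inv; case: cid => g []. Qed.

Lemma symgroup_invK f : cancel (symgroup_inv f) f.
Proof. by rewrite /symgroup_inv; case: cid => g []. Qed.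

Lemma symgroup_mulA : associative symgroup_mul.
Proof. by move=> f g h; exact: symgroupP. Qed.

Lemma symgroup_mul1 : left_id symgroup_one symgroup_mul.
Proof. by move=> f; exact: symgroupP. Qed.

Lemma symgroup_mul1r : right_id symgroup_one symgroup_mul.
Proof. by move=> f; exact: symgroupP. Qed.

Lemma symgroup_mulV : left_inverse symgroup_one symgroup_inv symgroup_mul.
Proof. by move=> f; apply: symgroupP => x; exact: symgroup_funK. Qed.

Lemma symgroup_mulVr : right_inverse symgroup_one symgroup_inv symgroup_mul.
Proof. by move=> f; apply: symgroupP => x; exact: symgroup_invK. Qed.

HB.instance Definition _ := isGroup.Build (symgroup X) symgroup_mulA
  symgroup_mul1 symgroup_mul1r symgroup_mulV symgroup_mulVr.

End symgroup_group.

Section symgroup_topology.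
Variable X : Type.

Definition symgroup_subbase : set (set (symgroup X)) :=
  [set A | exists x y, A = [set g : symgroup X | g x = y]].

HB.instance Definition _ :=
  isSubBaseTopological.Build (symgroup X) symgroup_subbase id.

Lemma symgroup_nbhs_eval (g : symgroup X) x :
  nbhs g [set h : symgroup X | h x = g x].
Proof.
rewrite nbhsE; exists [set h : symgroup X | h x = g x] => //; split => //.
exists [set [set h : symgroup X | h x = g x]]; last by rewrite bigcup_set1.
move=> _ ->; exists (fset1 [set h : symgroup X | h x = g x]).
  by move=> A /fset1P ->; rewrite inE; exists x, (g x).
apply/seteqP; split => [h|h hx A].
  by move=> /(_ _ (fset11 _)).
by rewrite /= => /fset1P ->.
Qed.

Lemma symgroup_cvg (F : set_system (symgroup X)) (g : symgroup X) :
  Filter F -> (forall x, F [set h : symgroup X | h x = g x]) -> F --> g.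
Proof.
move=> FF Fg A; rewrite nbhsE => -[B [[D Dfin <-] [I DI Ig]] DA].
apply: filterS (subset_trans (bigcup_sup (F := id) DI) DA) _.
have [J Jsub JI] := Dfin _ DI; rewrite -JI.
apply: filter_bigI => i iJ.
have := Jsub _ iJ; rewrite inE => -[x [y iE]].
have gi : i g by move: Ig; rewrite -JI; apply.
by move: gi; rewrite iE /= => <-.
Qed.

Lemma symgroup_mulg_continuous :
  continuous (fun u : symgroup X * symgroup X => u.1 * u.2).
Proof.
move=> [f g]; apply: symgroup_cvg => x /=.
exists ([set h : symgroup X | h (g x) = f (g x)],
        [set h : symgroup X | h x = g x]).
  by split; exact: symgroup_nbhs_eval.
by move=> [f' g'] /= [fE gE]; rewrite /mul /= gE fE.
Qed.

Lemma symgroup_invg_continuous : continuous (fun f : symgroup X => f^-1).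
Proof.
move=> f; apply: symgroup_cvg => [|x].
  exact/fmap_filter/(nbhs_filter (f : symgroup X)).
apply: filterS (symgroup_nbhs_eval f (symgroup_inv f x)) => h /= hE.
by rewrite -[x in LHS](symgroup_invK f x) -hE; exact: symgroup_funK.
Qed.

HB.instance Definition _ := PreTopologicalGroup_isTopologicalGroup.Build
  (symgroup X) symgroup_mulg_continuous symgroup_invg_continuous.

End symgroup_topology.

Section subgroup.
Variables (T : topologicalGroupType) (G : groupClosed T).

Definition subgroup_type : Type := {x : T | x \in G}.

HB.instance Definition _ := SubChoice.on subgroup_type.

Lemma subgroup_closed : group_closed [in G].
Proof. split; [exact: gpred1|by move=> x y; exact: gpredF]. Qed.

HB.instance Definition _ :=
  SubChoice_isSubGroup.Build T [in G] subgroup_type subgroup_closed.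
HB.instance Definition _ :=
  Topological.copy subgroup_type (initial_topology (val : subgroup_type -> T)).

Lemma subgroup_val_continuous : continuous (val : subgroup_type -> T).
Proof. exact: initial_continuous. Qed.

Lemma subgroup_mulg_continuous :
  continuous (fun u : subgroup_type * subgroup_type => u.1 * u.2).
Proof.
apply: continuous_comp_initial.
rewrite (_ : _ \o _ = (fun u : T * T => u.1 * u.2) \o
    (fun u : subgroup_type * subgroup_type => (val u.1, val u.2))); last first.
  by apply/funext => u; exact: valM.
move=> [f g]; apply: continuous_comp; last exact: mulg_continuous.
apply: cvg_pair.
- apply: (@cvg_comp _ _ _ fst val _ (nbhs f) _ cvg_fst).
  exact: subgroup_val_continuous.
- apply: (@cvg_comp _ _ _ snd val _ (nbhs g) _ cvg_snd).
  exact: subgroup_val_continuous.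
Qed.

Lemma subgroup_invg_continuous : continuous (fun f : subgroup_type => f^-1).
Proof.
apply: continuous_comp_initial.
rewrite (_ : _ \o _ = (fun x : T => x^-1) \o val); last first.
  by apply/funext => u; exact: SubK.
move=> f; apply: continuous_comp; last exact: invg_continuous.
exact: subgroup_val_continuous.
Qed.

HB.instance Definition _ := PreTopologicalGroup_isTopologicalGroup.Build
  subgroup_type subgroup_mulg_continuous subgroup_invg_continuous.

End subgroup.

Definition topological_embedding (T U : topologicalType) (f : T -> U) :=
  [/\ injective f, continuous f &
      forall A, open A -> exists2 B, open B & f @` A = B `&` range f].

Record semitopological_compactification (G : topologicalGroupType)
    (W : semitopologicalMonoidType) (w : G -> W) : Prop := {
  sc_compact : compact [set: W] ;
  sc_hausdorff : hausdorff_space W ;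
  sc_continuous : continuous w ;
  sc_morphism : monoid_morphism w ;
  sc_dense : dense (range w)
}.

Definition WAP_compactification (G : topologicalGroupType)
    (W : semitopologicalMonoidType) (w : G -> W) : Prop :=
  semitopological_compactification w /\
  forall (S : semitopologicalSemigroupType) (f : G -> S),
    compact [set: S] -> hausdorff_space S ->
    continuous f -> {morph f : x y / x * y} ->
    exists h : W -> S,
      [/\ continuous h, {morph h : x y / x * y} & forall g, h (w g) = f g].

Definition proper_compactification (G : topologicalGroupType)
    (W : semitopologicalMonoidType) (w : G -> W) : Prop :=
  semitopological_compactification w /\ topological_embedding w.

(* Main.v *)
Require Import Defs.
From HB Require Import structures.
From mathcomp Require Import all_boot monoid finmap all_classical topology.

(** The partial bijections of [X], seen as relations, form a semigroup under
    composition and a closed, hence compact Hausdorff, subspace of the product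
    [2^(X * X)].  Multiplication by a fixed partial bijection [a] is continuous:
    whether [(x, z)] lies in [a * s] depends on [s] only through the pair
    [(x, y)] where [y] is the unique possible point with [a y z].
    Sending a permutation to its graph embeds [S(X)], and hence [G], in this
    semigroup; this embedding factors through [w], so [w] is an embedding. *)

Set Implicit Arguments.
Unset Strict Implicit.
Unset Printing Implicit Defensive.

Local Open Scope classical_set_scope.

Record pbij (X : Type) := Pbij {
  pbij_rel :> X -> X -> Prop ;
  pbij_fun : forall x y z, pbij_rel x y -> pbij_rel x z -> y = z ;
  pbij_inj : forall x y z, pbij_rel x z -> pbij_rel y z -> x = y
}.

HB.instance Definition _ (X : Type) := gen_eqMixin (pbij X).
HB.instance Definition _ (X : Type) := gen_choiceMixin (pbij X).

Section pbij_semigroup.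
Variable X : Type.
Implicit Types s t : pbij X.

Lemma pbijP s t : (forall x y, s x y = t x y) -> s = t.
Proof.
case: s t => [s sf si] [t tf ti] /= st.
have {}st : s = t by apply/funext => x; apply/funext => y.
by rewrite st in sf si *; congr Pbij; exact: Prop_irrelevance.
Qed.

(** The right factor [b] acts first, as in the product of permutations; this makes [graph] a
    morphism. *)
Definition pbij_comp (a b : X -> X -> Prop) x z := exists2 y, b x y & a y z.

Lemma pbij_comp_fun s t x y z :
  pbij_comp s t x y -> pbij_comp s t x z -> y = z.
Proof.
by move=> [u xu uy] [v xv]; rewrite -(pbij_fun xu xv); exact: pbij_fun.
Qed.

Lemma pbij_comp_inj s t x y z :
  pbij_comp s t x z -> pbij_comp s t y z -> x = y.
Proof.
move=> [u xu uz] [v + vz]; rewrite -(pbij_inj uz vz); exact: pbij_inj.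
Qed.

Definition pbij_mul s t := Pbij (@pbij_comp_fun s t) (@pbij_comp_inj s t).

Lemma pbij_mulA : associative pbij_mul.
Proof.
move=> r s t; apply: pbijP => x z; apply/propext; split.
  by move=> [v [u xu uv] vz]; exists u => //; exists v.
by move=> [u xu [v uv vz]]; exists v => //; exists u.
Qed.

HB.instance Definition _ := isSemigroup.Build (pbij X) pbij_mulA.

End pbij_semigroup.

Section pbij_topology.
Variable X : Type.
Implicit Types s a : pbij X.

(** By propositional extensionality [P] is [True] or [False], so these sets generate the topology
    induced from [2^(X * X)]; both values are needed to make each evaluation locally constant. *)
Definition pbij_subbase : set (set (pbij X)) :=
  [set A | exists x y P, A = [set s : pbij X | s x y = P]].

HB.instance Definition _ :=
  isSubBaseTopological.Build (pbij X) pbij_subbase id.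

Lemma pbij_nbhs_eval s x y : nbhs s [set t : pbij X | t x y = s x y].
Proof.
rewrite nbhsE; exists [set t : pbij X | t x y = s x y] => //; split => //.
exists [set [set t : pbij X | t x y = s x y]]; last by rewrite bigcup_set1.
move=> _ ->; exists (fset1 [set t : pbij X | t x y = s x y]).
  by move=> A /fset1P ->; rewrite inE; exists x, y, (s x y).
apply/seteqP; split => [t|t tx A].
  by move=> /(_ _ (fset11 _)).
by rewrite /= => /fset1P ->.
Qed.

Lemma pbij_cvg (F : set_system (pbij X)) s :
  Filter F -> (forall x y, F [set t : pbij X | t x y = s x y]) -> F --> s.
Proof.
move=> FF Fs A; rewrite nbhsE => -[B [[D Dfin <-] [I DI Is]] DA].
apply: filterS (subset_trans (bigcup_sup (F := id) DI) DA) _.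
have [J Jsub JI] := Dfin _ DI; rewrite -JI.
apply: filter_bigI => i iJ.
have := Jsub _ iJ; rewrite inE => -[x [y [P iE]]].
have si : i s by move: Is; rewrite -JI; apply.
by move: si; rewrite iE /= => <-.
Qed.

Lemma pbij_hausdorff : hausdorff_space (pbij X).
Proof.
move=> s t st; apply: pbijP => x y.
by have [r [/= <- <-]] := st _ _ (pbij_nbhs_eval s x y) (pbij_nbhs_eval t x y).
Qed.

(** An ultrafilter [F] converges to the relation [r] of those pairs that belong to [F]-almost every
    [s]. Two members of [F] share a point, itself a partial bijection, so [r] is one too. *)
Lemma pbij_compact : compact [set: pbij X].
Proof.
rewrite compact_ultra => F FU _.
pose r x y := F [set s : pbij X | s x y].
have rf x y z : r x y -> r x z -> y = z.
  by move=> xy xz; have [s []] := filter_ex (filterI xy xz); exact: pbij_fun.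
have ri x y z : r x z -> r y z -> x = y.
  by move=> xz yz; have [s []] := filter_ex (filterI xz yz); exact: pbij_inj.
exists (Pbij rf ri); split => //; apply: pbij_cvg => x y /=.
have [rxy|nrxy] := in_ultra_setVsetC [set s : pbij X | s x y] FU.
  by apply: filterS (rxy) => s /= sxy; apply/propext; split.
apply: filterS (nrxy) => s /= sxy; apply/propext; split => // rxy.
by have [t []] := filter_ex (filterI rxy nrxy).
Qed.

Lemma pbij_mulgl_continuous a : continuous (fun s : pbij X => a * s)%g.
Proof.
move=> s; apply: pbij_cvg => [|x z].
  exact/fmap_filter/(nbhs_filter (s : pbij X)).
have [[y ayz]|na] := pselect (exists y, a y z).
  have E r : (a * r)%g x z = r x y.
    apply/propext; split => [[u xu uz]|xy]; last by exists y.
    by rewrite (pbij_inj ayz uz).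
  by apply: filterS (pbij_nbhs_eval s x y) => t txy; rewrite /preimage /mkset !E.
(* If [z] is outside the range of [a], no product [a * t] contains [(x, z)]: the evaluation is
   constantly false. *)
apply: (@filterE _ (nbhs (s : pbij X))) => t /=; apply/propext.
by split=> -[y _ ayz]; case: na; exists y.
Qed.

Lemma pbij_mulgr_continuous a : continuous (fun s : pbij X => s * a)%g.
Proof.
move=> s; apply: pbij_cvg => [|x z].
  exact/fmap_filter/(nbhs_filter (s : pbij X)).
have [[y axy]|na] := pselect (exists y, a x y).
  have E r : (r * a)%g x z = r y z.
    apply/propext; split => [[u xu uz]|yz]; last by exists y.
    by rewrite (pbij_fun axy xu).
  by apply: filterS (pbij_nbhs_eval s y z) => t tyz; rewrite /preimage /mkset !E.
apply: (@filterE _ (nbhs (s : pbij X))) => t /=; apply/propext.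
by split=> -[y axy _]; case: na; exists y.
Qed.

HB.instance Definition _ := PreTopologicalSemigroup_isSemitopological.Build
  (pbij X) pbij_mulgl_continuous pbij_mulgr_continuous.

End pbij_topology.

Section graph.
Variable X : Type.
Implicit Types f g : symgroup X.

Lemma graph_fun f x y z : f x = y -> f x = z -> y = z.
Proof. by move=> <-. Qed.

Lemma graph_inj f x y z : f x = z -> f y = z -> x = y.
Proof. by move=> <- /esym/(bij_inj (symgroup_bij f)). Qed.

Definition graph f := Pbij (@graph_fun f) (@graph_inj f).

Lemma graphM : {morph graph : f g / (f * g)%g}.
Proof.
move=> f g; apply: pbijP => x z; apply/propext.
by split => [<-|[y <- <-]]; first exists (g x).
Qed.

Lemma graph_injective : injective graph.
Proof.
move=> f g fg; apply: symgroupP => x.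
by have : graph g x (f x) by rewrite -fg.
Qed.

Lemma graph_continuous : continuous graph.
Proof.
move=> f; apply: pbij_cvg => [|x y].
  exact/fmap_filter/(nbhs_filter (f : symgroup X)).
by apply: filterS (symgroup_nbhs_eval f x) => g /= ->.
Qed.

(** The sets [A] satisfying the conclusion form a filter [F], so it is enough that [F] contains the
    subbasic neighbourhoods of [f]. The condition is vacuous at relations that are not graphs of
    permutations. *)
Lemma graph_nbhs f (A : set (symgroup X)) :
  nbhs f A -> nbhs (graph f) [set s | forall g, graph g = s -> A g].
Proof.
pose F : set_system (symgroup X) := [set A : set (symgroup X) |
  nbhs (graph f) [set s | forall g, graph g = s -> A g]].
have FF : Filter F.
  split=> [|B C FB FC|B C BC].
  - by apply: (@filterE _ (nbhs (graph f))).
  - apply: (@filterS2 _ (nbhs (graph f)) _ _ _ _ _ FB FC) => s sB sC g gs.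
    by split; [exact: sB|exact: sC].
  - by apply: (@filterS _ (nbhs (graph f))) => s sB g gs; apply/BC/sB.
suff Ff : F --> f by exact: Ff.
apply: symgroup_cvg => x; apply: filterS (pbij_nbhs_eval (graph f) x (f x)).
by move=> s /= sf g gs; move: sf; rewrite -gs /= => ->.
Qed.

Lemma graph_preimage_open (A : set (symgroup X)) :
  open A -> exists2 B, open B & A = graph @^-1` B.
Proof.
move=> Ao; exists [set s | forall g, graph g = s -> A g]°.
  exact: open_interior.
apply/seteqP; split=> [g Ag|g /interior_subset]; last by apply.
exact/graph_nbhs/open_nbhs_nbhs.
Qed.

End graph.

Lemma topological_embedding_factor (T U V : topologicalType)
    (w : T -> U) (h : U -> V) (f : T -> V) :
  continuous w -> continuous h -> (forall x, h (w x) = f x) -> injective f ->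
  (forall A, open A -> exists2 B, open B & A = f @^-1` B) ->
  topological_embedding w.
Proof.
move=> wc hc hw fi fo; split; [|exact: wc|move=> A /fo[B Bo ->]].
  by move=> x y wxy; apply: fi; rewrite -!hw wxy.
exists (h @^-1` B); first by apply: open_comp => // x _; exact: hc.
apply/seteqP; split=> [_ [x Bx <-]|u [Bu [x _ xu]]].
  by split; [rewrite /= hw|exists x].
by exists x => //; move: Bu; rewrite -xu /= hw.
Qed.

Theorem corollary4p4 (X : Type) (hX : infinite_set [set: X])
  (G : groupClosed (symgroup X))
  (W : semitopologicalMonoidType) (w : subgroup_type G -> W) :
  WAP_compactification w -> proper_compactification w.
Proof.
move=> [wcpt wmax]; split=> //.
have fc : continuous (@graph X \o val : subgroup_type G -> pbij X).
  move=> g; apply: continuous_comp; first exact: subgroup_val_continuous.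
  exact: graph_continuous.
have fM : {morph (@graph X \o val : subgroup_type G -> pbij X) : x y / (x * y)%g}.
  by move=> x y; rewrite -graphM -valM.
have [h [hc _ hw]] := wmax _ _ (@pbij_compact X) (@pbij_hausdorff X) fc fM.
apply: topological_embedding_factor (sc_continuous wcpt) hc hw _ _.
  by move=> x y /graph_injective/val_inj.
(* Open sets of the subgroup are preimages under [val] of open sets of permutations, by definition
   of the initial topology. *)
by move=> _ [A /graph_preimage_open[B Bo ->] <-]; exists B.
Qed.
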